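(* Let $G$ be a simple graph with edges $e_1,\dots,e_q$. Let $e_{i_1},\dots,e_{i_{2s}}$ (with $s\ge 2$) be a sequence of edges of $G$ such that $\langle e_{i_1},\dots,e_{i_{2s}}\rangle$ is a connected subgraph of $G$ and $\{i_1,i_3,\dots,i_{2s-1}\}\cap\{i_2,i_4,\dots,i_{2s}\}=\emptyset$. Then $e_{i_1},\dots,e_{i_{2s}}$ is a simplicial even walk if and only if $e_{i_1},\dots,e_{i_{2s}}$ is a closed even walk in $G$.
   Context: A simple graph is viewed as a $1$-dimensional simplicial complex whose facets are its edges; $\langle e_{i_1},\dots,e_{i_{2s}}\rangle$ is the subgraph consisting of these edges and their endpoints. The edges in the sequence need not be distinct. Put $\alpha=(i_1,i_3,\dots,i_{2s-1})$ and $\beta=(i_2,i_4,\dots,i_{2s})$, tuples of indices in $\{1,\dots,q\}$, and $\mathrm{Supp}(\alpha)=\{i_1,i_3,\dots,i_{2s-1}\}$, $\mathrm{Supp}(\beta)=\{i_2,i_4,\dots,i_{2s}\}$. For a vertex $x$ of $G$, $\deg_\alpha(x)$ is the number of positions in $\alpha$ (counted with repetition) whose edge contains $x$; similarly $\deg_\beta(x)$. The sequence $e_{i_1},\dots,e_{i_{2s}}$ is a simplicial even walk if for every $i\in\mathrm{Supp}(\alpha)$ and $j\in\mathrm{Supp}(\beta)$ we have $e_i\setminus e_j\not\subseteq\{x:\deg_\alpha(x)>\deg_\beta(x)\}$ and $e_j\setminus e_i\not\subseteq\{x:\deg_\alpha(x)<\deg_\beta(x)\}$. A walk of length $n$ in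 $G$ is a list $e'_1,\dots,e'_n$ of not necessarily distinct edges for which there are vertices $x_1,\dots,x_{n+1}$ with $e'_k=\{x_k,x_{k+1}\}$ for $1\le k\le n$; it is closed if $x_1=x_{n+1}$, and even if $n$ is even.
   Formalization: ''Is a closed even walk'' is read as: becomes one after permuting the odd-position edges among themselves and the even-position edges among themselves; in the given order the claim fails, e.g. e_1,e_4,e_3,e_2,e_5,e_6 in a 6-cycle is a simplicial even walk but not a walk. *)

(* Defs.v *)
From mathcomp Require Import all_boot.

Set Implicit Arguments.
Unset Strict Implicit.
Unset Printing Implicit Defensive.

Definition edges (V : finType) (G : rel V) : {set {set V}} :=
  [set f | [exists x, exists y, G x y && (f == [set x; y])]].

(* Tuples are 0-indexed, so i_1, i_3, ... sit at the even positions. *)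
Definition alpha (T : Type) (n : nat) (i : n.-tuple T) : seq T :=
  [seq tnth i k | k : 'I_n <- enum 'I_n & ~~ odd k].

Definition beta (T : Type) (n : nat) (i : n.-tuple T) : seq T :=
  [seq tnth i k | k : 'I_n <- enum 'I_n & odd k].

Section EdgeSequences.
Variables (V : finType) (q : nat) (e : 'I_q -> {set V}).

Definition deg (a : seq 'I_q) (x : V) : nat := count (fun k => x \in e k) a.

Definition simplicial_even_walk (n : nat) (i : n.-tuple 'I_q) : Prop :=
  forall k l : 'I_q, k \in alpha i -> l \in beta i ->
    ~~ (e k :\: e l \subset [set x | deg (alpha i) x > deg (beta i) x]) /\
    ~~ (e l :\: e k \subset [set x | deg (alpha i) x < deg (beta i) x]).

Definition span_vertices (i : seq 'I_q) : {set V} := \bigcup_(k <- i) e k.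

Definition span_adj (i : seq 'I_q) : rel V :=
  fun x y => has (fun k => e k == [set x; y]) i.

Definition span_connected (i : seq 'I_q) : Prop :=
  {in span_vertices i &, forall x y, connect (span_adj i) x y}.

End EdgeSequences.

Definition walk_along (V : finType) (G : rel V) (n : nat)
    (w : n.-tuple {set V}) (x : n.+1.-tuple V) : Prop :=
  forall k : 'I_n, tnth w k \in edges G /\
    tnth w k = [set tnth x (widen_ord (leqnSn n) k); tnth x (lift ord0 k)].

Definition closed_even_walk (V : finType) (G : rel V) (n : nat)
    (w : n.-tuple {set V}) : Prop :=
  ~~ odd n /\
  exists x : n.+1.-tuple V,
    walk_along G w x /\ tnth x ord0 = tnth x ord_max.

(* Being a simplicial even walk depends only on the multisets underlying alpha
   and beta, while being a walk depends on the order: for a 6-cycle with edges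
   e_1, ..., e_6 in cyclic order, e_1, e_4, e_3, e_2, e_5, e_6 is a simplicial
   even walk but not a walk in that order.  Closed even walks are therefore
   taken up to reordering alpha and beta, each separately.  Exchanging entries
   between alpha and beta is not allowed: it would not preserve simplicial even
   walks. *)
Definition reordering (T : eqType) (n : nat) (i j : n.-tuple T) : bool :=
  perm_eq (alpha i) (alpha j) && perm_eq (beta i) (beta j).

(* Main.v *)
(* Both conditions say that every vertex x satisfies deg_alpha(x) = deg_beta(x).
   If x has deg_alpha(x) > deg_beta(x), pick an alpha-edge {x, y}: the simplicial
   condition forces y outside every beta-edge, so y also has an alpha-excess, and
   then the whole edge violates the condition.  Conversely, a connected multigraph
   with balanced colours alpha, beta has an alternating Euler circuit (Kotzig):
   a trail leaving a vertex can always be continued with the other colour until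
   it closes up, and an alternating closed walk can be rebased at any of its
   vertices with an alpha-edge first (reversing it if necessary), so that further
   closed trails can be spliced in until all edges are used. *)
Require Import Defs.
From mathcomp Require Import all_boot zify.

Set Implicit Arguments.
Unset Strict Implicit.
Unset Printing Implicit Defensive.

(** * Splitting a list by the parity of positions *)

Fixpoint alternate (T : Type) (b : bool) (l : seq T) : seq T :=
  if l is x :: l' then
    if b then x :: alternate false l' else alternate true l'
  else [::].

Lemma alternate_cat (T : Type) b (l1 l2 : seq T) :
  alternate b (l1 ++ l2) =
    alternate b l1 ++ alternate (b (+) odd (size l1)) l2.
Proof.
elim: l1 b => [|x l1 IH] [] //=; rewrite IH //=.
by case: (odd _).
Qed.

(** First and last positions have the same parity exactly when the length is odd, so reversing a
    list of even length exchanges its two colour classes. *)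
Lemma alternate_rev (T : Type) b (l : seq T) :
  alternate b (rev l) = rev (alternate (b (+) ~~ odd (size l)) l).
Proof.
elim: l b => [|x l IH] b; first by case: b.
rewrite rev_cons -cats1 alternate_cat IH size_rev /= negbK.
case: b; case: (odd _) => //=; rewrite ?cats0 //.
all: by rewrite rev_cons cats1.
Qed.

Lemma perm_alternate (T : eqType) (l : seq T) :
  perm_eq (alternate true l ++ alternate false l) l.
Proof.
elim: l => //= x l IH.
by rewrite perm_cons perm_catC.
Qed.

(** Replaces filters over ordinals by a structural recursion, so that all later arguments are list
    inductions. *)
Lemma alphaE_betaE (T : Type) n (t : n.-tuple T) :
  alpha t = alternate true t /\ beta t = alternate false t.
Proof.
elim: n t => [|n IH] t.
  by rewrite /alpha /beta enum_ord0 (tuple0 t).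
case/tupleP: t => x t; have [IHa IHb] := IH t.
rewrite /= -IHa -IHb /alpha /beta enum_ordSl /= !filter_map -!map_comp.
split; [congr cons|].
  rewrite (@eq_filter _ _ (fun k : 'I_n => odd k)) => [|k /=]; last exact: negbK.
  by apply: eq_map => k /=; rewrite tnthS.
by apply: eq_map => k /=; rewrite tnthS.
Qed.

Local Arguments deg : simpl never.

(** * Degrees and the simplicial condition *)

Section Walks.
Variables (V : finType) (q : nat) (e : 'I_q -> {set V}).
Hypothesis card_e : forall k, #|e k| = 2.

Local Notation deg := (deg e).

Lemma edge_at k x : x \in e k -> exists2 y, x != y & e k = [set x; y].
Proof.
have /eqP/cards2P[u [v [uv ->]]] := card_e k.
rewrite !inE => /orP[] /eqP ->; first by exists v.
by exists u; [rewrite eq_sym|rewrite setUC].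
Qed.

Lemma edge_neq k x y : e k = [set x; y] -> x != y.
Proof. by move=> ek; have := card_e k; rewrite ek cards2; case: eqP. Qed.

(** The ends of an edge are distinct, so membership is a sum of two indicators; this turns degree
    bookkeeping into linear arithmetic. *)
Lemma in_edge k x y v : e k = [set x; y] -> (v \in e k) = (v == x) + (v == y) :> nat.
Proof.
move=> ek; have := edge_neq ek; rewrite ek !inE.
by have [->|] := eqVneq v x; case: eqP.
Qed.

Lemma perm_deg a b : perm_eq a b -> deg a =1 deg b.
Proof. by move=> /permP ab x; exact: ab. Qed.

Lemma deg_cat a b x : deg (a ++ b) x = deg a x + deg b x.
Proof. exact: count_cat. Qed.

Lemma deg_cons k a x : deg (k :: a) x = (x \in e k) + deg a x.
Proof. by []. Qed.

Lemma deg_gt0P a x : reflect (exists2 k, k \in a & x \in e k) (0 < deg a x).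
Proof. by rewrite -has_count; apply: hasP. Qed.

(** Only one half of the simplicial condition is assumed, so exchanging [a] and [b] yields the
    reverse inequality. *)
Lemma no_excess (a b : seq 'I_q) :
    (forall k l, k \in a -> l \in b ->
       ~~ (e k :\: e l \subset [set x | deg a x > deg b x])) ->
  b != [::] -> forall x, deg a x <= deg b x.
Proof.
move=> hab b0 x; rewrite leqNgt; apply/negP => dx.
have /deg_gt0P[k ka xk] : 0 < deg a x by apply: leq_ltn_trans dx.
have [y xy ek] := edge_at xk.
(* If [y] were on [e l], then [e k :\: e l] would contain at most [x], which has an excess. *)
have yNb l : l \in b -> y \notin e l.
  move=> lb; apply: contra (hab k l ka lb) => yl; apply/subsetP => v.
  rewrite ek !inE => /andP[vl /orP[/eqP ->//|/eqP vy]].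
  by rewrite vy yl in vl.
have dy : deg a y > deg b y.
  have -> : deg b y = 0.
    apply/eqP; rewrite -leqn0 leqNgt; apply/deg_gt0P => -[l /yNb].
    by move=> /negP.
  by apply/deg_gt0P; exists k => //; rewrite ek !inE eqxx orbT.
have [l lb] : exists l, l \in b.
  by case: (b) b0 => // l b' _; exists l; rewrite mem_head.
(* Both ends of [e k] now have an excess, so any [l] in [b] contradicts the hypothesis. *)
case/negP: (hab k l ka lb); apply/subsetP => v.
by rewrite ek !inE => /andP[_ /orP[] /eqP ->].
Qed.

(** * Walks as edge lists *)

Fixpoint walk (x : V) (l : seq 'I_q) (y : V) : Prop :=
  if l is k :: l' then exists2 z, e k = [set x; z] & walk z l' y else x = y.

Lemma walk_cat x l1 l2 y :
  walk x (l1 ++ l2) y <-> exists2 z, walk x l1 z & walk z l2 y.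
Proof.
elim: l1 x => [|k l1 IH] x /=.
  by split=> [|[z -> //]]; exists x.
split=> [[u ek /IH[z w1 w2]]|[z [u ek w1] w2]].
  by exists z => //; exists u.
by exists u => //; apply/IH; exists z.
Qed.

Lemma walk_rev x l y : walk x l y -> walk y (rev l) x.
Proof.
elim: l x => [|k l IH] x /= => [-> //|[z ek /IH w]].
rewrite rev_cons -cats1; apply/walk_cat; exists z => //=.
by exists x => //; rewrite setUC.
Qed.

(** Existentially hidden vertices let [walk] be cut, joined and reversed as a list; this recovers
    the explicit vertex tuple required by [walk_along]. *)
Lemma walk_tupleP n (l : n.-tuple 'I_q) x y :
  walk x l y <-> exists t : n.+1.-tuple V,
    (forall k : 'I_n, e (tnth l k) =
       [set tnth t (widen_ord (leqnSn n) k); tnth t (lift ord0 k)]) /\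
    tnth t ord0 = x /\ tnth t ord_max = y.
Proof.
elim: n l x y => [|n IH] l x y.
  rewrite (tuple0 l) /=; split=> [->|[t [_ [<- <-]]]].
    by exists [tuple y]; split=> [[]|].
  by congr tnth; apply: val_inj.
case/tupleP: l => k l /=.
have wS (j : 'I_n) : widen_ord (leqnSn n.+1) (lift ord0 j) =
    lift ord0 (widen_ord (leqnSn n) j) by apply: val_inj.
have w0 : widen_ord (leqnSn n.+1) ord0 = ord0 by apply: val_inj.
have mS : ord_max = lift ord0 (@ord_max n) by apply: val_inj.
split=> [[z ek /IH[t [te [t0 tn]]]]|[t [te [<- <-]]]].
  exists [tuple of x :: t]; split; last by rewrite mS tnthS.
  move=> j; have [i ->|->] := unliftP ord0 j; first by rewrite wS !tnthS te.
  by rewrite w0 tnthS !tnth0 t0 -ek.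
move: te; case/tupleP: t => x' t te.
exists (tnth t ord0); first by have := te ord0; rewrite w0 tnthS !tnth0.
rewrite mS tnthS; apply/IH; exists t; split=> // j.
by have := te (lift ord0 j); rewrite wS !tnthS.
Qed.

(** At each interior visit the incoming and outgoing edges have opposite colours and cancel. Only
    the two ends remain; the last edge has the colour of the first exactly when the length is
    odd. *)
Lemma walk_deg x l y v : walk x l y ->
  if odd (size l)
  then deg (alternate true l) v = deg (alternate false l) v + (v == x) + (v == y)
  else deg (alternate true l) v + (v == y) = deg (alternate false l) v + (v == x).
Proof.
elim: l x => [|k l IH] x /=; first by move=> ->.
move=> [z ek /IH]; rewrite deg_cons (in_edge v ek).
by case: (odd _) => /=; lia.
Qed.

(** * Alternating circuits: change of base vertex and closing of trails *)

Definition alternating_circuit (v : V) (A B : seq 'I_q) : Prop :=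
  exists l, [/\ walk v l v, ~~ odd (size l),
    perm_eq (alternate true l) A & perm_eq (alternate false l) B].

Lemma circuit_cat v A B A' B' : alternating_circuit v A B ->
  alternating_circuit v A' B' -> alternating_circuit v (A ++ A') (B ++ B').
Proof.
move=> [l [w o a b]] [l' [w' o' a' b']]; exists (l ++ l'); split.
- by apply/walk_cat; exists v.
- by rewrite size_cat oddD (negbTE o).
- by rewrite alternate_cat (negbTE o); apply: perm_cat.
- by rewrite alternate_cat (negbTE o); apply: perm_cat.
Qed.

(** When [l1] has even length, rotation preserves colours. When it is odd, rotation exchanges them,
    and traversing the rotated circuit backwards exchanges them again. *)
Lemma circuit_rot x v l1 l2 : walk x l1 v -> walk v l2 x ->
    ~~ odd (size (l1 ++ l2)) ->
  alternating_circuit v (alternate true (l1 ++ l2)) (alternate false (l1 ++ l2)).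
Proof.
move=> w1 w2; rewrite size_cat oddD => o.
have w : walk v (l2 ++ l1) v by apply/walk_cat; exists x.
have [o1|e1] := boolP (odd (size l1)); last first.
  move: o; rewrite (negbTE e1) /= => e2.
  exists (l2 ++ l1); rewrite !alternate_cat size_cat oddD (negbTE e1) (negbTE e2) /=.
  by split=> //; rewrite perm_catC.
move: o; rewrite o1 /= negbK => o2.
exists (rev (l2 ++ l1)); split; first exact: walk_rev.
- by rewrite size_rev size_cat oddD o1 o2.
- rewrite alternate_rev size_cat oddD !alternate_cat o1 o2 /=.
  by rewrite perm_rev perm_catC.
- rewrite alternate_rev size_cat oddD !alternate_cat o1 o2 /=.
  by rewrite perm_rev perm_catC.
Qed.

Lemma circuit_rebase x v A B k : alternating_circuit x A B ->
  k \in A ++ B -> v \in e k -> alternating_circuit v A B.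
Proof.
move=> [l [w o a b]] kAB vk.
have kl : k \in l.
  by rewrite -(perm_mem (perm_cat a b)) (perm_mem (perm_alternate l)) in kAB.
suff [l' [w' o' a' b']] :
    alternating_circuit v (alternate true l) (alternate false l).
  by exists l'; split=> //; [apply: perm_trans a' a|apply: perm_trans b' b].
move: w o; case/splitPr: kl => l1 l2 w o.
have /walk_cat[u w1 [z ek w2]] := w.
move: vk; rewrite ek !inE => /orP[] /eqP ->.
  by apply: (@circuit_rot x) => //; exists z.
(* Here [v] is the end reached after traversing [k], so the circuit is cut after [k] instead of
   before it. *)
rewrite -cat_rcons in o *; apply: (@circuit_rot x) => //.
by rewrite -cats1; apply/walk_cat; exists u => //; exists z.
Qed.

Lemma two_steps A B x y :
    (forall v, deg A v + (v == x) = deg B v + (v == y)) -> 0 < deg A y ->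
  exists a b z A1 B1,
    [/\ perm_eq A (a :: A1), perm_eq B (b :: B1), walk y [:: a; b] z
      & forall v, deg A1 v + (v == x) = deg B1 v + (v == z)].
Proof.
move=> bal /deg_gt0P[a aA ya].
have [u yu ea] := edge_at ya.
have pA := perm_to_rem aA; set A1 := rem a A in pA.
have bal1 v : deg A1 v + (v == x) + (v == u) = deg B v.
  by have := bal v; rewrite (perm_deg pA) deg_cons (in_edge v ea); lia.
have /deg_gt0P[b bB ub] : 0 < deg B u by rewrite -bal1 eqxx addn1.
have [z uz eb] := edge_at ub.
exists a, b, z, A1, (rem b B); split=> //; first exact: perm_to_rem.
  by exists u => //; exists z.
move=> v; have := bal1 v.
by rewrite (perm_deg (perm_to_rem bB)) deg_cons (in_edge v eb); lia.
Qed.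

(** As long as [y] differs from [x], balance at [y] gives it one more edge in [A] than in [B], so
    the trail can continue. Each continuation shrinks [A], hence the trail must reach [x]. *)
Lemma close_trail A B x y :
    (forall v, deg A v + (v == x) = deg B v + (v == y)) ->
  exists l A' B', [/\ walk y l x, ~~ odd (size l),
    perm_eq A (alternate true l ++ A') & perm_eq B (alternate false l ++ B')].
Proof.
have [n] := ubnP (size A); elim: n A B y => // n IH A B y sA bal.
have [<-|xy] := eqVneq x y; first by exists [::], A, B; split.
have dy : 0 < deg A y.
  by have := bal y; rewrite eqxx eq_sym (negbTE xy); lia.
have [a [b [z [A1 [B1 [pA pB w bal1]]]]]] := two_steps bal dy.
have [|l [A' [B' [wl ol pA1 pB1]]]] := IH A1 B1 z _ bal1.
  by move: sA; rewrite (perm_size pA).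
exists [:: a, b & l], A', B'; split.
- by rewrite -(cat1s b) -(cat1s a) catA; apply/walk_cat; exists z.
- by rewrite /= negbK.
- by apply: perm_trans pA _; rewrite /= perm_cons.
- by apply: perm_trans pB _; rewrite /= perm_cons.
Qed.

Lemma circuit_at A B v : deg A =1 deg B -> 0 < deg A v ->
  exists A1 B1 A' B', [/\ alternating_circuit v A1 B1, A1 != [::],
    perm_eq A (A1 ++ A') & perm_eq B (B1 ++ B')].
Proof.
move=> bal dv.
have bal0 u : deg A u + (u == v) = deg B u + (u == v) by rewrite bal.
(* Two steps are taken before [close_trail], which at [v] itself could return the empty trail. *)
have [a [b [z [A1 [B1 [pA pB w bal1]]]]]] := two_steps bal0 dv.
have [l [A' [B' [wl ol pA1 pB1]]]] := close_trail bal1.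
exists (a :: alternate true l), (b :: alternate false l), A', B'; split=> //.
- exists [:: a, b & l]; split=> //=; last by rewrite negbK.
  by apply/(@walk_cat v [:: a; b] l v); exists z.
- by apply: perm_trans pA _; rewrite /= perm_cons.
- by apply: perm_trans pB _; rewrite /= perm_cons.
Qed.

(** * Existence of an alternating Euler circuit *)

Lemma alternating_euler (s A B : seq 'I_q) :
    span_connected e s -> perm_eq s (A ++ B) -> deg A =1 deg B -> s != [::] ->
  exists x, alternating_circuit x A B.
Proof.
move=> conn ps bal s0.
have spanP k v : k \in s -> v \in e k -> v \in span_vertices e s.
  by move=> ks vk; rewrite /span_vertices bigcup_seq; apply/bigcupP; exists k.
have [x0 x0s] : exists x0, x0 \in span_vertices e s.
  case: s s0 spanP {conn ps} => // k s _ spanP.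
  have /card_gt0P[v vk] : 0 < #|e k| by rewrite card_e.
  by exists v; apply: spanP vk; rewrite mem_head.
suff main n x A0 B0 A' B' : size A' < n -> x \in span_vertices e s ->
    alternating_circuit x A0 B0 ->
    perm_eq A (A0 ++ A') -> perm_eq B (B0 ++ B') ->
    exists x, alternating_circuit x A B.
  apply: (main (size A).+1 x0 [::] [::] A B) => //.
  by exists [::]; split.
elim: n x A0 B0 A' B' => // n IH x A0 B0 A' B' sA' xs c pA pB.
have sE j : (j \in s) = (j \in A0 ++ B0) || (j \in A' ++ B').
  rewrite (perm_mem ps) mem_cat (perm_mem pA) (perm_mem pB) !mem_cat.
  by rewrite -!orbA; congr orb; rewrite orbCA.
have bal0 : deg A0 =1 deg B0.
  move=> v; have [l [w o a b]] := c.
  have := walk_deg v w; rewrite (negbTE o) (perm_deg a) (perm_deg b).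
  by move/addIn.
have bal' : deg A' =1 deg B'.
  move=> v; have := bal v.
  by rewrite (perm_deg pA) (perm_deg pB) !deg_cat bal0; move/addnI.
have [AB0|[k kAB]] : A' ++ B' = [::] \/ exists k, k \in A' ++ B'.
- by case: (A' ++ B') => [|k r]; [left|right; exists k; rewrite mem_head].
- move: pA pB; case: A' B' AB0 {sA' sE bal'} => // -[] // _; rewrite !cats0 => pA pB.
  exists x; have [l [w o a b]] := c; exists l; split=> //.
    by rewrite (perm_trans a) // perm_sym.
  by rewrite (perm_trans b) // perm_sym.
have deg'P j v : j \in A' ++ B' -> v \in e j -> 0 < deg A' v.
  rewrite mem_cat => /orP[] jAB vj; last rewrite bal'.
    by apply/deg_gt0P; exists j.
  by apply/deg_gt0P; exists j.
have [v cv dv] : exists2 v, alternating_circuit v A0 B0 & 0 < deg A' v.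
  have /card_gt0P[y yk] : 0 < #|e k| by rewrite card_e.
  have ys : y \in span_vertices e s.
    by apply: spanP yk; rewrite sE kAB orbT.
  have dy := deg'P _ _ kAB yk.
  have /connectP[p] := conn x y xs ys.
  elim: p x c {xs} => [|u p IHp] x c /=.
    by move=> _ yx; exists x; last rewrite -yx.
  move=> /andP[/hasP[j js /eqP ej] pth] lst.
  have xj : x \in e j by rewrite ej !inE eqxx.
  move: js; rewrite sE => /orP[] jAB.
  - apply: (IHp u) => //; apply: circuit_rebase c jAB _.
    by rewrite ej !inE eqxx orbT.
  - by exists x => //; apply: deg'P xj.
have [A1 [B1 [A2 [B2 [c1 nA1 pA' pB']]]]] := circuit_at bal' dv.
apply: (IH v (A0 ++ A1) (B0 ++ B1) A2 B2).
- move: sA'; rewrite (perm_size pA') size_cat.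
  by case: A1 nA1 {c1 pA'} => //= a A1 _; lia.
- have /deg_gt0P[j jA' vj] := dv.
  by apply: spanP vj; rewrite sE !mem_cat jA' /= orbT.
- exact: circuit_cat.
- by rewrite (perm_trans pA) // -catA perm_cat2l.
- by rewrite (perm_trans pB) // -catA perm_cat2l.
Qed.

End Walks.

(** * The equivalence through balanced degrees *)

Lemma card_edge (V : finType) (G : rel V) (f : {set V}) :
  irreflexive G -> f \in edges G -> #|f| = 2.
Proof.
move=> irr; rewrite inE => /existsP[x /existsP[y /andP[Gxy /eqP ->]]].
by rewrite cards2; case: eqP Gxy => // ->; rewrite irr.
Qed.

(** With balanced degrees both excess sets are empty, so the condition only asks that no edge of one
    colour be contained in an edge of the other. This holds because they are distinct sets of size
    2, by disjointness and injectivity. *)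
Lemma simplicial_even_walk_balanced (V : finType) (q : nat) (e : 'I_q -> {set V})
    (n : nat) (i : n.-tuple 'I_q) :
    (forall k, #|e k| = 2) -> injective e -> 1 < n ->
    (forall k : 'I_q, ~ (k \in alpha i /\ k \in beta i)) ->
  simplicial_even_walk e i <-> deg e (alpha i) =1 deg e (beta i).
Proof.
move=> card_e e_inj n1 disj; split=> [sew x|bal k l ka lb].
  have [a0 b0] : alpha i != [::] /\ beta i != [::].
    have [-> ->] := alphaE_betaE i; move: (size_tuple i) n1.
    by case: (tval i) => [|? []] //= <-.
  apply/eqP; rewrite eqn_leq !no_excess //.
    by move=> l k lb ka; have [] := sew k l ka lb.
  by move=> k l ka lb; have [] := sew k l ka lb.
have -> : [set x | deg e (alpha i) x > deg e (beta i) x] = set0.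
  by apply/setP => x; rewrite !inE bal ltnn.
have -> : [set x | deg e (alpha i) x < deg e (beta i) x] = set0.
  by apply/setP => x; rewrite !inE bal ltnn.
have ekl : ~~ (e k \subset e l).
  apply/negP => kl; have /e_inj kE : e k = e l.
    by apply/eqP; rewrite eqEcard kl !card_e.
  by apply: (disj k); split; rewrite // kE.
have elk : ~~ (e l \subset e k).
  by apply: contra ekl => lk; rewrite (_ : e k = e l) //; apply/esym/eqP;
    rewrite eqEcard lk !card_e.
by rewrite !subset0 !setD_eq0.
Qed.

Theorem corollary3p24 (V : finType) (G : rel V)
    (G_sym : symmetric G) (G_irr : irreflexive G)
    (q : nat) (e : 'I_q -> {set V})
    (e_inj : injective e) (e_edges : [set e k | k : 'I_q] = edges G)
    (s : nat) (s_ge2 : 2 <= s) (i : (2 * s).-tuple 'I_q)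
    (i_conn : span_connected e i)
    (i_disj : forall k : 'I_q, ~ (k \in alpha i /\ k \in beta i)) :
  simplicial_even_walk e i <->
  exists j : (2 * s).-tuple 'I_q,
    reordering i j /\ closed_even_walk G (map_tuple e j).
Proof.
have eG k : e k \in edges G by rewrite -e_edges imset_f.
have card_e k : #|e k| = 2 := card_edge G_irr (eG k).
have s1 : 1 < 2 * s by lia.
have odd2s : ~~ odd (2 * s) by rewrite oddM.
apply: (iff_trans (simplicial_even_walk_balanced card_e e_inj s1 i_disj)).
have pi : perm_eq i (alpha i ++ beta i).
  by have [-> ->] := alphaE_betaE i; rewrite perm_sym perm_alternate.
split=> [bal|[j [/andP[pa pb] [_ [t [wt closed_t]]]]]].
  have [|x [l [w o a b]]] := alternating_euler card_e i_conn pi bal.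
    by rewrite -size_eq0 size_tuple -lt0n ltnW.
  have sl : size l == 2 * s.
    rewrite -(size_tuple i) (perm_size pi) -(perm_size (perm_cat a b)).
    by rewrite (perm_size (perm_alternate l)).
  exists (Tuple sl); split.
    rewrite /reordering; have [-> ->] := alphaE_betaE (Tuple sl).
    by rewrite perm_sym a perm_sym b.
  split=> //; have [t [te [t0 tn]]] := (walk_tupleP e (Tuple sl) x x).1 w.
  exists t; split; last by rewrite t0 tn.
  by move=> k; rewrite tnth_map -te; split.
have w : walk e (tnth t ord0) j (tnth t ord0).
  apply/walk_tupleP; exists t; split=> // k.
  by have [_] := wt k; rewrite tnth_map.
move=> v; rewrite (perm_deg e pa) (perm_deg e pb).
have [-> ->] := alphaE_betaE j.
(* For a closed walk of even length the two end terms coincide and cancel. *)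
by have := walk_deg card_e v w; rewrite size_tuple (negbTE odd2s); move/addIn.
Qed.
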